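(* Let $G$ be a finite directed graph (possibly cyclic), consider a finite functional causal model on $G$, and consider any classical teleportation model, on a teleportation graph $G_{\mathrm t}\in\mathcal G_{\mathrm{tele}}(G)$, derived from it. Then whether or not the probabilities $P(x)_G$ of the model on $G$ are defined, and the values they take if they are defined, do not depend on the choices of the classical post-selected teleportation protocols made (for the split vertices) in the construction of the teleportation model. That is, for any two classical teleportation models on the same $G_{\mathrm t}$ derived from the same model on $G$, the post-selection success probability of one is non-zero if and only if that of the other is, and in this case both give the same values $P(x)_G$ for all $x=\{x_v\in\mathcal X_v\}_{v\in V}$.
   Context: Graphs. A directed graph $G=(V,E)$ has a finite vertex set $V$ and edges $E\subseteq V\times V$, $(v,w)$ being an edge from $v$ to $w$. $\mathrm{Pa}(v)=\{w:(w,v)\in E\}$, $\mathrm{Ch}(v)=\{w:(v,w)\in E\}$, $\mathrm{out}(v)=\{(v,w)\in E\}$. Finite functional causal model (fCM) on $G$. To each $v\in V$ assign: a random variable $X_v$ with values $x_v$ in a non-empty finite set $\mathcal X_v$; an error variable $U_v$ with values $u_v$ in a finite set $\mathcal U_v$ with probability distribution $p^v$ on $\mathcal U_v$; a function $f^v:\prod_{w\in \mathrm{Pa}(v)}\mathcal X_w\times\mathcal U_v\to\mathcal X_v$. If $G$ is acyclic, its distribution is $P_{\mathrm{acyc}}(x)_G=\sum_u\prod_{v\in V}p^v(u_v)\,\delta_{x_v,f^v(x_{\mathrm{Pa}(v)},u_v)}$ for $x=\{x_v\}_{v\in V}$, the sum being over all $u=\{u_v\in\mathcal U_v\}_{v\in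 V}$. Classical post-selected teleportation protocol on a finite set $\mathcal X_A=\mathcal X_C$: a finite set $\mathcal X_B$, a function $g:\mathcal X_A\times\mathcal X_B\times\mathcal X_C\to\{0,1\}$ and probability distributions $q_B$ on $\mathcal X_B$, $q_C$ on $\mathcal X_C$ such that for all probability distributions $p^A$ on $\mathcal X_A$ and all $c\in\mathcal X_C$, $\sum_{a,b}p^A(a)\,\delta_{g(a,b,c),1}\,q_B(b)\,q_C(c)=p_{\mathrm{tele}}\,p^A(c)$, where $p_{\mathrm{tele}}\in(0,1]$ (independent of $p^A$) is the success probability. Teleportation graphs. The family $\mathcal G_{\mathrm{tele}}(G)$ consists of all graphs $G_{\mathrm{t}}$ obtained thus: choose $S\subseteq V$ (''split vertices'') such that $(V,E')$ with $E'=E\setminus\bigcup_{v\in S}\mathrm{out}(v)$ is acyclic. The vertices of $G_{\mathrm t}$ are $V\cup\{R_v\}_{v\in S}\cup\{T_v\}_{v\in S}$ with new vertices $R_v$ (pre-selection) and $T_v$ (post-selection). The edges are $E'\cup\{(v,T_v),(R_v,T_v)\}_{v\in S}\cup\{(R_v,w): v\in S,\ w\in\mathrm{Ch}(v)\text{ in }G\}$. All such $G_{\mathrm t}$ are acyclic. Teleportation models. Given an fCM on $G$ and $G_{\mathrm t}\in\mathcal G_{\mathrm{tele}}(G)$, a classical teleportation model on $G_{\mathrm t}$ is an fCM in which: for each $v\in S$, $T_v$ takes values $t_v\in\{0,1\}$, $R_v$ takes values $r_v\in\mathcal X_v$ and equals its error variable, and the function $f^{T_v}$ with the error distributions $p^{T_v},p^{R_v}$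 form a classical post-selected teleportation protocol ($g=f^{T_v}$ with arguments the value of $v$, the error of $T_v$, and the value of $R_v$; $q_B=p^{T_v}$, $q_C=p^{R_v}$); every $w\in V$ keeps the same sets, error variable and function as in the fCM on $G$, where $r_v$ replaces $x_v$ as an input for each $v\in S\cap \mathrm{Pa}(w)$ (parents in $G$). Probabilities in $G$. For a teleportation model on $G_{\mathrm t}$ the post-selection success probability is $P_{\mathrm{succ}}=P_{\mathrm{acyc}}(\{t_v=1\}_{v\in S})_{G_{\mathrm t}}$. If $P_{\mathrm{succ}}>0$ one defines $P(x)_G:=P_{\mathrm{acyc}}(x\mid\{t_v=1\}_{v\in S})_{G_{\mathrm t}}$ for $x=\{x_v\in\mathcal X_v\}_{v\in V}$ (values of $R_v$ marginalized). If $P_{\mathrm{succ}}=0$, $P(\cdot)_G$ is undefined. *)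

(* Defs.v *)
From HB Require Import structures.
From mathcomp Require Import all_boot all_order all_algebra.

Set Implicit Arguments.
Unset Strict Implicit.
Unset Printing Implicit Defensive.

Import Order.TTheory GRing.Theory Num.Theory.
Local Open Scope ring_scope.

(* A directed graph is a finite type [V] with [E : rel V]; [E v w] is an edge
   from [v] to [w].  Self-loops are cycles of length one. *)
Definition acyclic (V : finType) (E : rel V) : Prop :=
  forall c : seq V, cycle E c -> c = [::].

Definition is_dist (R : realFieldType) (T : finType) (p : T -> R) : Prop :=
  (forall t, 0 <= p t) /\ \sum_t p t = 1.

(* Values of a family of variables at the parents of [v]. *)
Definition parent_val (V : finType) (E : rel V) (X : V -> finType) (v : V) :=
  {dffun forall w : {w : V | E w v}, X (val w)}.

Record fCM (R : realFieldType) (V : finType) (E : rel V) := FCM {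
  fcm_val : V -> finType;
  fcm_val_neq0 : forall v, (0 < #|fcm_val v|)%N;
  fcm_err : V -> finType;
  fcm_dist : forall v, fcm_err v -> R;
  fcm_distP : forall v, is_dist (@fcm_dist v);
  fcm_fun : forall v, parent_val E fcm_val v -> fcm_err v -> fcm_val v
}.
Arguments fcm_dist {R V E} _ v _.
Arguments fcm_fun {R V E} _ v _ _.

Section Distribution.
Variables (R : realFieldType) (V : finType) (E : rel V) (M : fCM R E).

Definition outcome := {dffun forall v, fcm_val M v}.

Definition restr_parents (x : outcome) (v : V) : parent_val E (fcm_val M) v :=
  [ffun w => x (val w)].

(* Only meaningful as a probability distribution when [E] is acyclic. *)
Definition Pacyc (x : outcome) : R :=
  \sum_(u : {dffun forall v, fcm_err M v})
    \prod_(v : V) (fcm_dist M v (u v)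
                   * (x v == fcm_fun M v (restr_parents x v) (u v))%:R).

Definition Pacyc_event (A : pred outcome) : R := \sum_(x | A x) Pacyc x.

Definition Pacyc_cond (A B : pred outcome) : R :=
  Pacyc_event (predI A B) / Pacyc_event B.

End Distribution.

Record protocol (R : realFieldType) (A : finType) := Protocol {
  tele_B : finType;
  tele_g : A -> tele_B -> A -> bool;
  tele_qB : tele_B -> R;
  tele_qC : A -> R;
  tele_qB_dist : is_dist tele_qB;
  tele_qC_dist : is_dist tele_qC;
  tele_prob : R;
  tele_prob_bounds : 0 < tele_prob <= 1;
  tele_eq : forall pA : A -> R, is_dist pA -> forall c : A,
    \sum_(a : A) \sum_(b : tele_B)
       pA a * (tele_g a b c == true)%:R * tele_qB b * tele_qC c
    = tele_prob * pA c
}.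
Arguments tele_g {R A} _ _ _ _.
Arguments tele_qB {R A} _ _.
Arguments tele_qC {R A} _ _.

Section TeleportationGraph.
Variables (V : finType) (E : rel V) (S : {set V}).

Definition cut_edge : rel V := [rel v w | E v w && (v \notin S)].

Definition splits_cycles : Prop := acyclic cut_edge.

Definition split_vertex := {v : V | v \in S}.

Definition tele_vertex : finType := (V + (split_vertex + split_vertex))%type.
Definition orig (v : V) : tele_vertex := inl v.
Definition pre (s : split_vertex) : tele_vertex := inr (inl s).
Definition post (s : split_vertex) : tele_vertex := inr (inr s).

Definition tele_edge : rel tele_vertex := fun a b =>
  match a, b with
  | inl v, inl w => cut_edge v w
  | inl v, inr (inr t) => v == val t
  | inr (inl r), inr (inr t) => r == t
  | inr (inl r), inl w => E (val r) w
  | _, _ => false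
  end.

Lemma tele_edge_acyclic : splits_cycles -> acyclic tele_edge.
Proof.
move=> acS c cyc_c.
have in_V a : a \in c -> exists v, a = orig v.
  move=> ac; have := next_cycle cyc_c ac; have := prev_cycle cyc_c ac.
  case: a ac => [v|[r|t]] _ //; first by exists v.
  by case: (prev c _) => [v|[r'|t']].
have [c' def_c] : exists c', c = map orig c'.
  elim: c in_V {cyc_c} => [|a c IHc] in_V; first by exists [::].
  have [v ->] := in_V a (mem_head _ _).
  have [|c' ->] := IHc; last by exists (v :: c').
  by move=> b bc; apply: in_V; rewrite inE bc orbT.
move: cyc_c; rewrite def_c cycle_map => cyc_c.
by rewrite (acS c').
Qed.

End TeleportationGraph.

Section TeleportationModel.
Variables (R : realFieldType) (V : finType) (E : rel V) (M : fCM R E).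
Variables (S : {set V}).
Variable prot : forall s : split_vertex S, protocol R (fcm_val M (val s)).

Definition tele_val (a : tele_vertex S) : finType :=
  match a with
  | inl v => fcm_val M v
  | inr (inl r) => fcm_val M (val r)
  | inr (inr _) => bool
  end.

Definition tele_err (a : tele_vertex S) : finType :=
  match a with
  | inl v => fcm_err M v
  | inr (inl r) => fcm_val M (val r)
  | inr (inr t) => tele_B (prot t)
  end.

Definition tele_dist (a : tele_vertex S) : tele_err a -> R :=
  match a return tele_err a -> R with
  | inl v => fcm_dist M v
  | inr (inl r) => tele_qC (prot r)
  | inr (inr t) => tele_qB (prot t)
  end.

Notation tele_pval := (parent_val (tele_edge E (S := S)) tele_val).

Lemma cut_parent (w v : V) : E v w -> v \notin S ->
  tele_edge E (orig S v) (orig S w).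
Proof. by move=> Evw vS; apply/andP. Qed.

Lemma orig_post_parent (t : split_vertex S) :
  tele_edge E (orig S (val t)) (post t).
Proof. exact: eqxx. Qed.

Lemma pre_post_parent (t : split_vertex S) : tele_edge E (pre t) (post t).
Proof. exact: eqxx. Qed.

(* The input of a vertex [w] of the original graph: the value of [R_v] replaces
   that of [v] for each split parent [v]. *)
Definition tele_input (w : V) (y : tele_pval (orig S w)) :
    parent_val E (fcm_val M) w :=
  [ffun v : {v : V | E v w} =>
    match boolP (val v \in S) with
    | AltTrue vS =>
        y (exist (fun a => tele_edge E a (orig S w))
             (pre (exist _ (val v) vS)) (valP v))
    | AltFalse vNS =>
        y (exist (fun a => tele_edge E a (orig S w))
             (orig S (val v)) (cut_parent (valP v) vNS))
    end].

Definition tele_fun (a : tele_vertex S) :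
    tele_pval a -> tele_err a -> tele_val a :=
  match a return tele_pval a -> tele_err a -> tele_val a with
  | inl w => fun y u => fcm_fun M w (tele_input y) u
  | inr (inl r) => fun _ u => u
  | inr (inr t) => fun y b =>
      tele_g (prot t)
             (y (exist (fun a => tele_edge E a (post t))
                   (orig S (val t)) (orig_post_parent t)))
             b
             (y (exist (fun a => tele_edge E a (post t))
                   (pre t) (pre_post_parent t)))
  end.

Lemma tele_val_neq0 a : (0 < #|tele_val a|)%N.
Proof. by case: a => [v|[r|t]] /=; rewrite ?card_bool ?fcm_val_neq0. Qed.

Lemma tele_distP a : is_dist (@tele_dist a).
Proof.
case: a => [v|[r|t]] /=;
  [exact: fcm_distP | exact: tele_qC_dist | exact: tele_qB_dist].
Qed.

Definition tele_model : fCM R (tele_edge E (S := S)) :=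
  FCM tele_val_neq0 tele_distP tele_fun.

Definition post_selected : pred (outcome tele_model) :=
  [pred y : outcome tele_model |
     [forall t : split_vertex S, (y (post t) : bool) == true]].

Definition orig_values (x : outcome M) : pred (outcome tele_model) :=
  [pred y : outcome tele_model | [forall v : V, (y (orig S v) : fcm_val M v) == x v]].

Definition Psucc : R := Pacyc_event post_selected.

(* Undefined when [Psucc] is zero: the value is then the junk value [_ / 0]. *)
Definition PG (x : outcome M) : R := Pacyc_cond (orig_values x) post_selected.

End TeleportationModel.

(* Main.v *)
(* Summing out the error variables, the tele-model gives an outcome with all
   [t_v = 1] the weight [(prod_s p_tele s) * prod_w h_w * prod_s [r_s = x_s]]:
   testing the protocol equation on the point mass at [a] shows that
   [sum_b g(a,b,c) q_B(b) q_C(c) = p_tele [a = c]].  Hence [r_s] is forced to be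
   [x_s], and the joint probability of [x] and post-selection success is
   [prod_s p_tele s] times the expression [Pacyc M x] evaluated on the possibly
   cyclic [G].  The positive protocol-dependent constant cancels. *)
Require Import Defs.
From mathcomp Require Import all_boot all_order all_algebra.

Import Order.TTheory GRing.Theory Num.Theory.
Local Open Scope ring_scope.

(** Dependent choices become, via [fprod], functions into a tagged union, where ordinary
    distributivity of products over sums applies. *)
Lemma sum_prod_dffun (R : comNzRingType) (I : finType) (T : I -> finType)
    (F : forall i, T i -> R) :
  \sum_(u : {dffun forall i, T i}) \prod_i F i (u i) =
  \prod_i \sum_(t : T i) F i t.
Proof.
pose G i := [ffun t => F i t].
rewrite (reindex (dffun_of_fprod (T_:=T))) /=; last first.
  exact/onW_bij/dffun_of_fprod_bij.
transitivity (\sum_(t : fprod T) \prod_(i in I) G i (t i)).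
  by apply: eq_bigr => t _; apply: eq_bigr => i _; rewrite !ffunE.
rewrite (big_fprod _ _ G) -(bigA_distr_big_dep (fun i => tagged_with T i)
  (fun i j => untag 0 (G i) j)).
apply: eq_bigr => i _; rewrite -(big_tag (fun i => G i)).
by apply: eq_bigr => t _; rewrite ffunE.
Qed.

(** For fixed [x], the factor at [v] involves only the error of [v], so the sum over all errors
    factorizes. *)
Lemma Pacyc_prod {R : realFieldType} {V : finType} {E : rel V} (M : fCM R E)
    (x : outcome M) :
  Pacyc x = \prod_v \sum_(u : fcm_err M v)
    fcm_dist M v u * (x v == fcm_fun M v (restr_parents x v) u)%:R.
Proof.
exact: (sum_prod_dffun _ _ _ (fun v u =>
  fcm_dist M v u * (x v == fcm_fun M v (restr_parents x v) u)%:R)).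
Qed.

Lemma is_dist_pred1 {R : realFieldType} {T : finType} (a : T) :
  is_dist (fun t => (t == a)%:R : R).
Proof.
split=> [t|]; first exact: ler0n.
by rewrite (bigD1 a) //= eqxx big1 ?addr0 // => t /negPf->.
Qed.

Lemma protocol_pointwise {R : realFieldType} {A : finType} (p : protocol R A)
    (a c : A) :
  \sum_b tele_qB p b * (tele_g p a b c)%:R * tele_qC p c =
  tele_prob p * (c == a)%:R.
Proof.
rewrite -(tele_eq p (is_dist_pred1 a)) [RHS](bigD1 a) //= [X in _ + X]big1.
  rewrite addr0; apply: eq_bigr => b _.
  by rewrite eqxx mul1r eqb_id [_%:R * _]mulrC.
by move=> a' /negPf->; rewrite big1 // => b _; rewrite !mul0r.
Qed.

Section TeleportationModel.
Variables (R : realFieldType) (V : finType) (E : rel V) (M : fCM R E).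
Variables (S : {set V}).
Variable prot : forall s : split_vertex S, protocol R (fcm_val M (val s)).
Local Notation N := (tele_model prot).

Definition tele_const : R := \prod_s tele_prob (prot s).

Lemma tele_const_gt0 : 0 < tele_const.
Proof. by apply: prodr_gt0 => s _; case/andP: (tele_prob_bounds (prot s)). Qed.

(** The only post-selected outcome over [x] that can carry weight. *)
Definition tele_lift (x : outcome M) : outcome N :=
  [ffun a : tele_vertex S => match a return tele_val M a with
    | inl v => x v
    | inr (inl r) => x (val r)
    | inr (inr _) => true
    end].

Lemma tele_input_lift (x : outcome M) (w : V) :
  tele_input (restr_parents (tele_lift x) (orig S w)) = restr_parents x w.
Proof.
by apply/ffunP => v; rewrite !ffunE; case: {-}_ / boolP => vS; rewrite !ffunE.
Qed.

Lemma Pacyc_post_selected (y : outcome N) : post_selected y ->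
  Pacyc y = tele_const *
    ((\prod_w \sum_(u : fcm_err M w) fcm_dist M w u *
        ((y (orig S w) : fcm_val M w) ==
          fcm_fun M w (tele_input (restr_parents y (orig S w))) u)%:R) *
     \prod_s ((y (pre s) : fcm_val M (val s)) == y (orig S (val s)))%:R).
Proof.
move/forallP=> y1; rewrite Pacyc_prod /= !big_sumType /= [RHS]mulrCA; congr (_ * _).
rewrite -!big_split; apply: eq_bigr => s _ /=.
(* The factors of [post s] and [pre s] together form the left side of the protocol identity at the
   point mass on the value of [s]. *)
rewrite -protocol_pointwise -mulr_suml mulrC; congr (_ * _).
  apply: eq_bigr => b _; rewrite (eqP (y1 s)) !ffunE /=.
  by rewrite [true == _]eq_sym eqb_id.
rewrite (bigD1 (y (pre s))) //= eqxx mulr1 big1 ?addr0 // => c /negPf ne_c.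
by rewrite eq_sym ne_c mulr0.
Qed.

Lemma Pacyc_event_orig_values (x : outcome M) :
  Pacyc_event (predI (orig_values (prot:=prot) x) (post_selected (prot:=prot))) =
  tele_const * Pacyc x.
Proof.
have x1 : post_selected (tele_lift x).
  by apply/forallP => t; rewrite ffunE.
have xx : orig_values (prot:=prot) x (tele_lift x).
  by apply/forallP => v; rewrite ffunE.
rewrite /Pacyc_event (bigD1 (tele_lift x)) /=; last by rewrite xx.
rewrite [X in _ + X]big1 => [|y /andP[/andP[yx y1] ne_y]].
  rewrite addr0 Pacyc_post_selected // Pacyc_prod; congr (_ * _).
  rewrite [X in _ * X]big1 => [|s _]; last by rewrite !ffunE eqxx.
  rewrite mulr1; apply: eq_bigr => w _; apply: eq_bigr => u _.
  by rewrite tele_input_lift ffunE.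
rewrite Pacyc_post_selected //.
(* If every [pre s] copies its split vertex, then [y] is [tele_lift x], which is excluded; otherwise
   one indicator factor is 0. *)
have [/forallP yr|] := boolP [forall s : split_vertex S,
    (y (pre s) : fcm_val M (val s)) == y (orig S (val s))].
  case/eqP: ne_y; apply/ffunP => -[v|[r|t]]; rewrite ffunE.
  - by have /eqP := forallP yx v.
  - by have /eqP -> := yr r; have /eqP := forallP yx (val r).
  - by have /eqP := forallP y1 t.
rewrite negb_forall => /existsP[s /negPf ne_s].
by rewrite [X in _ * (_ * X)](bigD1 s) //= ne_s mul0r !mulr0.
Qed.

(** Post-selected outcomes are grouped by their original values. The remaining sum need not be 1
    when the graph is cyclic. *)
Lemma PsuccE : Psucc prot = tele_const * \sum_(x : outcome M) Pacyc x.
Proof.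
pose proj (y : outcome N) : outcome M :=
  [ffun v => (y (orig S v) : fcm_val M v)].
rewrite /Psucc /Pacyc_event (partition_big proj xpredT) //= mulr_sumr.
apply: eq_bigr => x _; rewrite -Pacyc_event_orig_values.
apply: eq_bigl => y; rewrite /= andbC; congr (_ && _).
apply/eqP/forallP => [<- v | yx]; first by rewrite ffunE.
by apply/ffunP => v; rewrite ffunE; have /eqP := yx v.
Qed.

(** Only the positive [tele_const] is cancelled, so this also holds when the denominator is 0: both
    sides are then 0 by convention. *)
Lemma PGE (x : outcome M) :
  PG prot x = Pacyc x / \sum_(x' : outcome M) Pacyc x'.
Proof.
rewrite /PG /Pacyc_cond Pacyc_event_orig_values -/(Psucc prot) PsuccE.
by rewrite -mulf_div divff ?mul1r // gt_eqF // tele_const_gt0.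
Qed.

End TeleportationModel.

Theorem corollary1 (R : realFieldType) (V : finType) (E : rel V) (M : fCM R E)
    (S : {set V}) (hS : splits_cycles E S)
    (prot1 prot2 : forall s : split_vertex S, protocol R (fcm_val M (val s))) :
  (Psucc prot1 != 0 <-> Psucc prot2 != 0) /\
  (Psucc prot1 != 0 -> forall x : outcome M, PG prot1 x = PG prot2 x).
Proof.
split=> [|_ x]; last by rewrite !PGE.
(* Both conditions reduce to the non-vanishing of the same protocol-free sum. *)
by rewrite !PsuccE !mulf_eq0 !(gt_eqF (tele_const_gt0 _ _ _ _ _ _)).
Qed.
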